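(* Fix integers $k\ge 2$ and $\ell\ge 0$ with $\ell<k/2$. Let $b_0=\frac{n}{2k\log n}$. Then, for all sufficiently large $n$ divisible by $k-\ell$, Maker wins the Hamilton $\ell$-cycle Game on $H_{n,k}$ with bias $b$ whenever $b\le b_0$.
   Context: $H_{n,k}$ is the complete $k$-uniform hypergraph on $n$ vertices. In a Maker-Breaker game with bias $b$ (a positive integer) on $H_{n,k}$, two players alternately claim previously unclaimed edges: in each round Maker first claims one edge and then Breaker claims $b$ edges (or all remaining edges, if fewer than $b$ remain). Play continues until all edges are claimed. Maker wins if the hypergraph formed by the edges she has claimed has the desired property. ''Maker wins'' means that Maker has a winning strategy. In the Hamilton $\ell$-cycle Game the desired property is that Maker's hypergraph contains a Hamilton $\ell$-cycle: for some ordering $v_1,\dots,v_n$ of all the vertices, the $n/(k-\ell)$ edges $\{v_1,\dots,v_k\},\{v_{k-\ell+1},\dots,v_{2k-\ell}\},\dots$, i.e. the edges $\{v_{(k-\ell)j+1},\dots,v_{(k-\ell)j+k}\}$ for $0\le j<n/(k-\ell)$, with subscripts taken modulo $n$, so that each edge in the sequence intersects the previous one in $\ell$ vertices. For $\ell=0$ a Hamilton $0$-cycle is a perfect matching, i.e. a set of $n/k$ pairwise disjoint edges covering all vertices. Here $\log$ is the natural logarithm. *)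

(* Defs.v *)
From HB Require Import structures.
From mathcomp Require Import all_boot all_order all_algebra all_fingroup.
From mathcomp Require Import reals exp.

Set Implicit Arguments.
Unset Strict Implicit.
Unset Printing Implicit Defensive.

(** ** Biased Maker-Breaker games on a finite board *)

(* A history is the list of completed rounds, oldest first; a round (e, S)
   consists of Maker's element e and the set S of Breaker's elements. *)
Definition history (E : finType) := seq (E * {set E}).

Definition maker_claimed (E : finType) (h : history E) : {set E} :=
  [set e in unzip1 h].

Definition breaker_claimed (E : finType) (h : history E) : {set E} :=
  \bigcup_(r <- h) r.2.

Definition free_elements (E : finType) (board : {set E}) (h : history E) : {set E} :=
  board :\: (maker_claimed h :|: breaker_claimed h).

Definition maker_strategy (E : finType) := history E -> E.

(* The partial plays in which Maker follows sigma and Breaker, with bias b,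
   plays arbitrarily within the rules: he claims exactly b free elements, or
   all the remaining ones if there are fewer than b. *)
Inductive play (E : finType) (board : {set E}) (b : nat)
    (sigma : maker_strategy E) : history E -> Prop :=
| play_start : play board b sigma [::]
| play_round (h : history E) (S : {set E}) :
    play board b sigma h ->
    free_elements board h != set0 ->
    S \subset free_elements board h :\ sigma h ->
    #|S| = minn b #|free_elements board h :\ sigma h| ->
    play board b sigma (rcons h (sigma h, S)).

(* The first clause says that sigma only makes legal moves. Each round uses up
   at least one element, so every play can be continued until none is free. *)
Definition winning_strategy (E : finType) (board : {set E}) (b : nat)
    (goal : {set E} -> Prop) (sigma : maker_strategy E) : Prop :=
  (forall h, play board b sigma h ->
     free_elements board h != set0 -> sigma h \in free_elements board h) /\
  (forall h, play board b sigma h ->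
     free_elements board h = set0 -> goal (maker_claimed h)).

Definition maker_wins (E : finType) (board : {set E}) (b : nat)
    (goal : {set E} -> Prop) : Prop :=
  exists sigma : maker_strategy E, winning_strategy board b goal sigma.

(** ** Hypergraphs and Hamilton l-cycles *)

Definition complete_hypergraph (n k : nat) : {set {set 'I_n}} :=
  [set e : {set 'I_n} | #|e| == k].

(* With the vertices ordered as v 0, ..., v (n - 1), the j-th edge (from j = 0)
   of an l-cycle: the images under v of the positions (k - l) * j + i, for
   0 <= i < k, taken modulo n. *)
Definition cycle_edge (n k l : nat) (v : {perm 'I_n}) (j : nat) : {set 'I_n} :=
  [set v p | p : 'I_n & [exists i : 'I_k, val p == ((k - l) * j + i) %% n]].

(* Meant for k - l dividing n. For l = 0 the edges are consecutive disjoint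
   blocks of length k covering all positions, i.e. a perfect matching. *)
Definition contains_hamilton_cycle (n k l : nat) (F : {set {set 'I_n}}) : Prop :=
  exists v : {perm 'I_n},
    forall j : nat, j < n %/ (k - l) -> cycle_edge k l v j \in F.

Definition maker_wins_hamilton_cycle_game (n k l b : nat) : Prop :=
  maker_wins (complete_hypergraph n k) b (contains_hamilton_cycle k l).

(* Main.v *)
(* Fix the cyclic order of the positions. Position the [j]-th edge of the cycle at
   the block [j] of length [k - l] together with the first [l] positions of the next
   block, and let only the vertex at the end of each block vary. A pair [(j, x)] then
   gives an edge of the hypergraph, distinct pairs give distinct edges, and a perfect
   matching of K_{t,t}, [t = n / (k - l)], gives a Hamilton l-cycle. So it suffices
   that Maker builds a perfect matching of K_{m,m} when [b * ln (2 * m) <= m / 2] and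
   [b] is a small fraction of [m].

   In a first stage of at most 6m rounds Maker serves every vertex three times: she
   claims an edge from it to one of its at least m/4 neighbours not yet lost to
   Breaker. The order of service is dictated by the total exponential weight of the
   vertices at which Breaker has claimed more than m/10 edges. There are only O(b) of
   these, so edges between two of them can be ignored and each Breaker edge counts at
   one endpoint only; this is what gives the bias the right constant. The choice of
   the neighbour derandomises a uniform one: the expected number of pairs (A, C) with
   [#|A| = #|C|] small and all choices of A falling into C starts below 1 and does not
   increase. Hence small sets expand. In a second stage Beck's potential makes Maker
   meet all products of two large sets, and Hall's condition holds. *)
Require Import Defs.
From mathcomp Require Import all_boot all_order all_algebra all_fingroup.
From mathcomp Require Import boolp reals sequences exp.
From mathcomp Require Import zify ring lra.

Set Implicit Arguments.
Unset Strict Implicit.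
Unset Printing Implicit Defensive.

Import Order.TTheory GRing.Theory Num.Theory.

(** * Strategies from invariants *)

Lemma maker_claimed_rcons (E : finType) (h : history E) e (S : {set E}) :
  maker_claimed (rcons h (e, S)) = e |: maker_claimed h.
Proof.
by apply/setP=> x; rewrite !inE /unzip1 map_rcons mem_rcons inE.
Qed.

Lemma breaker_claimed_rcons (E : finType) (h : history E) e (S : {set E}) :
  breaker_claimed (rcons h (e, S)) = breaker_claimed h :|: S.
Proof. by rewrite /breaker_claimed -cats1 big_cat big_seq1. Qed.

(** An invariant [P], seen through [phi], stands in for a strategy. When [D] is empty or already
    owned, Maker plays any free element: surplus elements do no harm, as [P] must survive for every
    [M'] containing [M :|: D]. Injectivity of [phi] keeps Breaker's visible move within [b]. *)
Lemma maker_wins_pullback (E F : finType) (e0 : E) (board : {set E}) (b : nat)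
    (goal : {set E} -> Prop) (phi : F -> E) (P : {set F} -> {set F} -> Prop) :
  injective phi -> (forall x, phi x \in board) ->
  P set0 set0 ->
  (forall M B : {set F}, [disjoint M & B] -> P M B ->
     exists D : {set F}, [/\ #|D| <= 1, [disjoint D & B] &
       forall M' S : {set F}, M :|: D \subset M' -> [disjoint M' & B :|: S] ->
         #|S| <= b -> P M' (B :|: S)]) ->
  (forall M B : {set E}, board \subset M :|: B ->
     P (phi @^-1: M) (phi @^-1: B) -> goal M) ->
  maker_wins board b goal.
Proof.
move=> phi_inj phi_board P0 Pstep Pend.
pose M (h : history E) := maker_claimed h; pose B (h : history E) := breaker_claimed h.
pose inv h := [disjoint M h & B h] /\ P (phi @^-1: M h) (phi @^-1: B h).
(* The hypotheses stand under the existential so that [choice] yields a strategy on all histories;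
   [e0] is a junk move. *)
have step h : exists e, inv h -> free_elements board h != set0 ->
    e \in free_elements board h /\
    forall S : {set E}, S \subset free_elements board h :\ e -> #|S| <= b -> inv (rcons h (e, S)).
  case: (pselect (inv h)) => [[dMB PMB]|]; last by exists e0.
  case: (set_0Vmem (free_elements board h)) => [->|[f ffree]].
    by exists e0 => _ /eqP.
  have [|D [cD dD DP]] := Pstep _ _ _ PMB.
    by rewrite -setI_eq0 -preimsetI (disjoint_setI0 dMB) preimset0.
  have [e efree De] : exists2 e, e \in free_elements board h &
      D \subset phi @^-1: (e |: M h).
    have [D0|[x Dx]] := set_0Vmem D; first by exists f => //; rewrite D0 sub0set.
    have {}D1 : D = [set x].
      by apply/esym/eqP; rewrite eqEcard sub1set Dx cards1.
    have xB : phi x \notin B h.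
      by move: dD; rewrite D1 disjoints1 inE.
    have [xM|xM] := boolP (phi x \in M h).
      by exists f => //; rewrite D1 sub1set in_set in_setU1 xM orbT.
    exists (phi x); last by rewrite D1 sub1set in_set setU11.
    by rewrite /free_elements in_setD in_setU negb_or xM xB phi_board.
  exists e => _ _; split=> // S SD cS; rewrite /inv /M /B.
  rewrite maker_claimed_rcons breaker_claimed_rcons -/(M h) -/(B h).
  have dis : [disjoint e |: M h & B h :|: S].
    move: efree; rewrite /free_elements in_setD in_setU negb_or -/(M h) -/(B h) => /andP[/andP[eM eB] _].
    rewrite -setI_eq0; apply/eqP/setP=> z; rewrite in_setI in_setU1 in_setU in_set0.
    have [zB|zB] /= := boolP (z \in B h).
      rewrite andbT; apply: contraNF eB => /orP[/eqP <- //|zM].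
      by rewrite (disjointFr dMB zM) in zB.
    have [zS|] := boolP (z \in S); last by rewrite andbF.
    have := subsetP SD _ zS; rewrite in_setD1 /free_elements in_setD in_setU.
    by rewrite !negb_or -/(M h) => /andP[/negPf -> /andP[/andP[/negPf ->]]].
  split=> //; rewrite (preimsetU _ (B h)); apply: DP.
  - by rewrite subUset De preimsetS // subsetUr.
  - by rewrite -setI_eq0 -preimsetU -preimsetI (disjoint_setI0 dis) preimset0.
  - apply: leq_trans cS; rewrite -(card_imset _ phi_inj); apply: subset_leq_card.
    by apply/subsetP=> z /imsetP[y]; rewrite inE => Sy ->.
have [sigma sP] := choice step.
have playinv h : play board b sigma h -> inv h.
  elim=> [|{}h S _ IH hfree SD cS]; last first.
    by have [_] := sP h IH hfree; apply=> //; rewrite cS geq_minl.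
  have M0 : M [::] = set0 by apply/setP=> z; rewrite !inE.
  by rewrite /inv M0 /B /breaker_claimed big_nil !preimset0 -setI_eq0 set0I.
exists sigma; split=> h hplay hfree.
  by have [] := sP h (playinv h hplay) hfree.
have [_ Ph] := playinv h hplay; apply: Pend Ph.
by rewrite -setD_eq0; apply/eqP.
Qed.

(** * Hall's theorem *)

Definition nbhd (T U : finType) (r : T -> U -> bool) (A : {set T}) : {set U} :=
  [set y | [exists x in A, r x y]].

Lemma nbhdP (T U : finType) (r : T -> U -> bool) (A : {set T}) y :
  reflect (exists2 x, x \in A & r x y) (y \in nbhd r A).
Proof. by rewrite inE; apply: exists_inP. Qed.

Lemma nbhdU (T U : finType) (r : T -> U -> bool) (A B : {set T}) :
  nbhd r (A :|: B) = nbhd r A :|: nbhd r B.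
Proof.
apply/setP=> y; rewrite in_setU; apply/nbhdP/orP.
  by case=> x; rewrite inE => /orP[] xA rxy; [left|right]; apply/nbhdP; exists x.
by case=> /nbhdP[x xA rxy]; exists x; rewrite // inE xA ?orbT.
Qed.

(** Induction on [#|X|]. If some nonempty proper [A] is tight, [A] and [X :\: A] are matched
    separately, the latter outside [nbhd r A]. Otherwise every such set has a spare neighbour, and
    any edge at [x0] may be fixed first. *)
Lemma hall_in (T U : finType) (u0 : U) (r : T -> U -> bool) (X : {set T})
    (Y : {set U}) :
  (forall A : {set T}, A \subset X -> #|A| <= #|nbhd r A :&: Y|) ->
  exists f : T -> U,
    {in X &, injective f} /\ {in X, forall x, r x (f x) && (f x \in Y)}.
Proof.
have [N] := ubnP #|X|; elim: N X Y => // N IH X Y ltXN hallX.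
have [->|[x0 x0X]] := set_0Vmem X.
  by exists (fun=> u0); split=> x; rewrite inE.
have [/existsP[A /and3P[AX A0 tight]]|loose] :=
    boolP [exists A : {set T}, [&& A \proper X, A != set0 & #|nbhd r A :&: Y| <= #|A|]].
  have sAX := proper_sub AX.
  have ltA := proper_card AX.
  have A_gt0 : 0 < #|A| by rewrite card_gt0.
  have [||f [finj fr]] := IH A Y; first by lia.
    by move=> A' A'A; apply: hallX; apply: subset_trans sAX.
  have cXA : #|X :\: A| = #|X| - #|A| by rewrite cardsD (setIidPr sAX).
  have [||g [ginj gr]] := IH (X :\: A) (Y :\: nbhd r A); first by rewrite cXA; lia.
    move=> A' A'X.
    have dA' : A :&: A' = set0.
      by apply/eqP; rewrite setI_eq0 disjoint_sym; move: A'X; rewrite subsetD => /andP[].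
    have := hallX (A :|: A').
    rewrite subUset sAX (subset_trans A'X (subsetDl _ _)) => /(_ isT).
    rewrite cardsU dA' cards0 nbhdU setIUl.
    have -> : nbhd r A :&: Y :|: nbhd r A' :&: Y =
        (nbhd r A :&: Y) :|: (nbhd r A' :&: (Y :\: nbhd r A)).
      by apply/setP=> y; rewrite !(in_setU, in_setI, in_setD);
         case: (y \in nbhd r A) (y \in Y) (y \in nbhd r A') => [] [] [].
    by rewrite cardsU; lia.
  exists (fun x => if x \in A then f x else g x); split=> [x y xX yX|x xX].
    have neq u v : u \in A -> v \in X -> v \notin A -> f u != g v.
      move=> uA vX vA; have /andP[ru _] := fr u uA.
      have /gr/andP[_] : v \in X :\: A by rewrite inE vA.
      rewrite inE => /andP[+ _]; apply: contraNneq => <-.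
      by apply/nbhdP; exists u.
    case: ifPn => xA; case: ifPn => yA; first exact: finj.
    - by move=> E; move: (neq x y xA yX yA); rewrite E eqxx.
    - by move=> E; move: (neq y x yA xX xA); rewrite E eqxx.
    - by apply: ginj; rewrite inE ?xA ?yA.
  case: ifPn => xA; first exact: fr.
  by have /gr : x \in X :\: A by [rewrite inE xA]; rewrite !in_setD => /and3P[-> _ ->].
have [y0] : exists y, y \in nbhd r [set x0] :&: Y.
  apply/set0Pn; rewrite -card_gt0; apply: leq_trans (hallX [set x0] _).
    by rewrite cards1.
  by rewrite sub1set.
rewrite inE => /andP[/nbhdP[z /set1P -> rxy0] y0Y].
have [||f [finj fr]] := IH (X :\ x0) (Y :\ y0).
- by move: ltXN; rewrite (cardsD1 x0 X) x0X.
- move=> A; rewrite subsetD1 => /andP[AX x0A].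
  have [->|A0] := eqVneq A set0; first by rewrite cards0.
  have : #|A| < #|nbhd r A :&: Y|.
    rewrite ltnNge; apply: contra loose => tight; apply/existsP; exists A.
    by rewrite A0 tight !andbT properE AX; apply: contra x0A => /subsetP; apply.
  rewrite (cardsD1 y0) setIDA => lt; rewrite -ltnS; apply: leq_trans lt _.
  by case: (_ \in _).
exists (fun x => if x == x0 then y0 else f x); split=> [x y xX yX|x xX].
  have neq u : u \in X -> u != x0 -> f u != y0.
    by move=> uX ux; have /fr/andP[_] : u \in X :\ x0; rewrite !inE ?ux // => /andP[].
  case: eqVneq => [->|xx0]; case: eqVneq => [->|yx0] //.
  - by move=> E; move: (neq y yX yx0); rewrite E eqxx.
  - by move=> E; move: (neq x xX xx0); rewrite E eqxx.
  - by apply: finj; rewrite !inE ?xx0 ?yx0.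
case: eqVneq => [->|xx0]; first by rewrite rxy0.
by have /fr : x \in X :\ x0 by [rewrite !inE xx0]; rewrite !inE => /and3P[-> _ ->].
Qed.

Lemma hall (T U : finType) (u0 : U) (r : T -> U -> bool) :
  (forall A : {set T}, #|A| <= #|nbhd r A|) ->
  exists2 f : T -> U, injective f & forall x, r x (f x).
Proof.
move=> hallT; have [|f [finj fr]] := hall_in u0 (r := r) (X := setT) (Y := setT).
  by move=> A _; rewrite setIT.
exists f => [x y|x]; first by apply: finj; rewrite inE.
by have /andP[] := fr x (in_setT x).
Qed.

(** * Hamilton cycles from matchings *)

Definition window (n k l j : nat) : {set 'I_n} :=
  [set p : 'I_n | [exists i : 'I_k, val p == ((k - l) * j + i) %% n]].

Lemma windowP n k l j (p : 'I_n) :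
  reflect (exists2 i, i < k & val p = ((k - l) * j + i) %% n) (p \in window n k l j).
Proof.
rewrite inE; apply: (iffP existsP) => [[i /eqP]|[i ik E]]; first by exists i.
by exists (Ordinal ik); apply/eqP.
Qed.

Lemma cycle_edgeE n k l (v : {perm 'I_n}) j : cycle_edge k l v j = v @: window n k l j.
Proof.
apply/setP=> q; apply/imsetP/imsetP=> -[p pj ->]; exists p => //.
Qed.

Lemma card_window n k l j : k <= n -> #|window n k l j| = k.
Proof.
case: n => [|n] kn; first by move: kn; rewrite leqn0 => /eqP ->; apply: eq_card0 => -[].
pose h (i : 'I_k) : 'I_n.+1 := inord (((k - l) * j + i) %% n.+1).
have hE i : val (h i) = ((k - l) * j + i) %% n.+1 by rewrite /h /= inordK // ltn_pmod.
have h_inj : injective h.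
  move=> i i' /(congr1 val); rewrite !hE => /eqP; rewrite eqn_modDl.
  by rewrite !modn_small ?(leq_trans (ltn_ord _) kn) // => /eqP/val_inj.
rewrite -[RHS]card_ord -(card_imset _ h_inj); apply: eq_card => p.
apply/windowP/imsetP => [[i ik E]|[i _ ->]]; last by exists i.
by exists (Ordinal ik) => //; apply: val_inj; rewrite hE.
Qed.

(* The only position of the [j]-th block whose vertex is not fixed in advance. *)
Definition block_end (n d j : nat) : 'I_n.+1 := inord (d * j + d.-1).

Lemma val_block_end n d t (j : 'I_t) :
  n.+1 = d * t -> 0 < d -> val (block_end n d j) = d * j + d.-1.
Proof.
move=> nE d0; rewrite /block_end /= inordK // nE.
have : d * j.+1 <= d * t by rewrite leq_mul2l ltn_ord orbT.
rewrite mulnS; lia.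
Qed.

Lemma block_end_inj n d t : n.+1 = d * t -> 0 < d ->
  injective (fun j : 'I_t => block_end n d j).
Proof.
move=> nE d0 j j' /(congr1 val); rewrite !(val_block_end _ nE) // => /eqP.
by rewrite eqn_add2r eqn_mul2l eqn0Ngt d0 => /eqP/val_inj.
Qed.

Lemma window_mod n k l t j (p : 'I_n) : n = (k - l) * t -> p \in window n k l j ->
  exists2 i, i < k & val p = ((k - l) * j + i) %% n /\ val p = i %[mod k - l].
Proof.
move=> nE /windowP[i ik E]; exists i => //; split=> //.
by rewrite E modn_dvdm ?nE ?dvdn_mulr // mulnC modnMDl.
Qed.

(** The window exceeds its own block by only [l < k - l] positions, so it stops short of the end of
    the next block. *)
Lemma block_end_window n k l t (j y : 'I_t) : n.+1 = (k - l) * t -> 2 * l < k ->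
  (block_end n (k - l) y \in window n.+1 k l j) = (y == j).
Proof.
move=> nE lk; have d0 : 0 < k - l by lia.
have jt : (k - l) * j + (k - l).-1 < n.+1.
  by have := ltn_ord (block_end n (k - l) j); rewrite (val_block_end j nE).
apply/idP/eqP => [|->]; last first.
  by apply/windowP; exists (k - l).-1; rewrite ?(val_block_end _ nE) ?modn_small //; lia.
move=> /(window_mod nE)[i ik]; rewrite (val_block_end _ nE) // => -[E].
rewrite mulnC modnMDl modn_small; last by lia.
have [id|id] := ltnP i (k - l); last first.
  rewrite -(subnK id) modnDr modn_small; lia.
rewrite modn_small // => iE; move: E; rewrite -iE modn_small // => /eqP.
by rewrite eqn_add2r eqn_mul2l eqn0Ngt d0 => /eqP/val_inj.
Qed.

Lemma block_start_window n k l t (j y : 'I_t) : n.+1 = (k - l) * t -> 2 * l < k ->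
  inord ((k - l) * y) \in window n.+1 k l j -> y = j :> nat \/ y = j.+1 %% t :> nat.
Proof.
move=> nE lk; have d0 : 0 < k - l by lia.
have lt_n (z : 'I_t) : (k - l) * z < n.+1 by rewrite nE ltn_pmul2l.
move=> /(window_mod nE)[i ik] /=; rewrite inordK // => -[E].
rewrite modnMr => /esym/eqP i0.
have [i1|i1] : i = 0 \/ i = k - l.
- have [id|id] := ltnP i (k - l); first by left; move: i0; rewrite modn_small // => /eqP.
  right; move: i0; rewrite -(subnK id) modnDr modn_small; lia.
- left; move: E; rewrite i1 addn0 nE -muln_modr (modn_small (ltn_ord j)) => /eqP.
  by rewrite eqn_mul2l eqn0Ngt d0 => /eqP.
right; move: E; rewrite i1 addnC -mulnS nE -muln_modr => /eqP.
by rewrite eqn_mul2l eqn0Ngt d0 => /eqP.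
Qed.

(** The transposition replaces the end of block [e.1] in its window by the end of block [e.2], which
    becomes the only block end in the edge. *)
Definition cycle_piece (n k l t : nat) (e : 'I_t * 'I_t) : {set 'I_n.+1} :=
  cycle_edge k l (tperm (block_end n (k - l) e.1) (block_end n (k - l) e.2)) e.1.

Lemma card_cycle_edge n k l (v : {perm 'I_n}) j : k <= n -> #|cycle_edge k l v j| = k.
Proof. by move=> kn; rewrite cycle_edgeE card_imset ?card_window //; apply: perm_inj. Qed.

Lemma mem_cycle_piece n k l t (e : 'I_t * 'I_t) p :
  (p \in cycle_piece n k l e) =
  (tperm (block_end n (k - l) e.1) (block_end n (k - l) e.2) p \in window n.+1 k l e.1).
Proof.
rewrite /cycle_piece cycle_edgeE; set v := tperm _ _.
by rewrite -(mem_imset _ (v p) (@perm_inj _ v)) tpermK.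
Qed.

(** The second index is read off from the only block end in the edge. Block starts are fixed by the
    transposition, so unless [j = j'] each of the two follows the other cyclically, which is
    impossible for [t > 2]. *)
Lemma cycle_piece_inj n k l t : n.+1 = (k - l) * t -> 2 <= k -> 2 * l < k -> 2 < t ->
  injective (cycle_piece n k l (t := t)).
Proof.
move=> nE k2 lk t2 [j x] [j' x'] Ejx.
have d0 : 0 < k - l by lia.
have L_inj := block_end_inj nE d0.
have Lmem (e : 'I_t * 'I_t) (y : 'I_t) : (block_end n (k - l) y \in cycle_piece n k l e) = (y == e.2).
  rewrite mem_cycle_piece; case: e => a b /=.
  have [->|yb] := eqVneq y b; first by rewrite tpermR block_end_window ?eqxx.
  have [Ea|ya] := eqVneq y a.
    by rewrite Ea tpermL block_end_window // eq_sym -Ea (negPf yb).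
  by rewrite tpermD ?block_end_window ?(negPf ya) // (inj_eq L_inj) eq_sym.
have xx' : x = x' by apply/eqP; rewrite -(Lmem (j', x')) -Ejx Lmem.
pose st (y : 'I_t) : 'I_n.+1 := inord ((k - l) * y).
have stE y : val (st y) = (k - l) * y by rewrite /st /= inordK // nE ltn_pmul2l.
(* Blocks have length [k - l >= 2], so their starts and ends differ. *)
have neq (z y : 'I_t) : block_end n (k - l) z != st y.
  apply/eqP => /(congr1 val); rewrite stE (val_block_end _ nE) //.
  move=> /(congr1 (modn^~ (k - l))); rewrite modnMr (mulnC _ z) modnMDl modn_small; lia.
have Smem (e : 'I_t * 'I_t) (y : 'I_t) :
    (st y \in cycle_piece n k l e) = (st y \in window n.+1 k l e.1).
  by rewrite mem_cycle_piece tpermD.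
have start (a b a' b' : 'I_t) : cycle_piece n k l (a, b) = cycle_piece n k l (a', b') ->
    a = a' :> nat \/ a = a'.+1 %% t :> nat.
  move=> E; apply: (block_start_window nE lk); rewrite -/(st a) -(Smem (a', b')) -E Smem.
  by apply/windowP; exists 0; rewrite ?stE ?addn0 ?modn_small ?nE ?ltn_pmul2l //; lia.
congr (_, _) => //; apply: val_inj => /=.
have [//|E1] := start _ _ _ _ Ejx; have [//|E2] := start _ _ _ _ (esym Ejx).
exfalso; move: E1 E2; have := ltn_ord j; have := ltn_ord j'.
have mS (a : nat) : a < t -> a.+1 %% t = if a.+1 == t then 0 else a.+1.
  by move=> at_; case: eqP => [->|]; rewrite ?modnn // => ?; rewrite modn_small //; lia.
by move=> h h'; rewrite !mS //; case: eqP; case: eqP; lia.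
Qed.

(** The ordering moves block ends by [f] and fixes all other positions. On window [j], which has a
    single block end, it agrees with the transposition defining the piece of [(j, f j)]. *)
Lemma hamilton_of_matching n k l t (M : {set {set 'I_n.+1}}) (f : 'I_t -> 'I_t) :
  n.+1 = (k - l) * t -> 2 * l < k -> injective f ->
  (forall j, cycle_piece n k l (j, f j) \in M) ->
  contains_hamilton_cycle k l M.
Proof.
move=> nE lk f_inj fM; have d0 : 0 < k - l by lia.
set d := k - l in nE d0.
have L_inj := block_end_inj nE d0; pose L (j : 'I_t) := block_end n d j.
have block_lt (p : 'I_n.+1) : p %/ d < t by rewrite ltn_divLR // mulnC -nE.
pose g (p : 'I_n.+1) := let j := Ordinal (block_lt p) in if p == L j then L (f j) else p.
have gL j : g (L j) = L (f j).
  rewrite /g (_ : Ordinal _ = j) ?eqxx //; apply: val_inj => /=.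
  have := val_block_end j nE d0; rewrite /= -/(L j) => ->.
  by rewrite mulnC divnMDl // divn_small ?addn0 //; lia.
have gN p : (forall j, p != L j) -> g p = p by move=> pL; rewrite /g (negPf (pL _)).
have g_cases p : (exists j, p = L j) \/ (forall j, p != L j).
  have [/existsP[j /eqP]|/existsPn] := boolP [exists j, p == L j]; first by left; exists j.
  by right.
have g_inj : injective g.
  move=> p q; have [[i ->]|pN] := g_cases p; have [[j ->]|qN] := g_cases q.
  - by rewrite !gL => /L_inj/f_inj ->.
  - by rewrite gL gN // => E; case/eqP: (qN (f i)).
  - by rewrite gL gN // => E; case/eqP: (pN (f j)).
  - by rewrite !gN.
exists (perm g_inj) => j; rewrite [X in X %/ _]nE mulKn // => jt.
have <- : cycle_piece n k l (Ordinal jt, f (Ordinal jt)) = cycle_edge k l (perm g_inj) j => //.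
rewrite /cycle_piece !cycle_edgeE /=; apply: eq_in_imset => p pj; rewrite [perm g_inj p]permE.
have [[i pE]|pN] := g_cases p; last first.
  by rewrite gN // tpermD // eq_sym; [apply: (pN (Ordinal jt))|apply: pN].
move: pj; rewrite pE (block_end_window (Ordinal jt) i nE lk) => /eqP ->.
by rewrite gL tpermL.
Qed.

(** * The complete bipartite graph *)

Definition vertex (m : nat) := (bool * 'I_m)%type.

(** The endpoint tagged [true] always comes first, so both endpoints name an edge by the same
    pair. *)
Definition edge (m : nat) (v : vertex m) (y : 'I_m) : 'I_m * 'I_m :=
  if v.1 then (v.2, y) else (y, v.2).

Definition other (m : nat) (v : vertex m) (y : 'I_m) : vertex m := (~~ v.1, y).

Definition deg (m : nat) (B : {set 'I_m * 'I_m}) (v : vertex m) : nat :=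
  #|[set y | edge v y \in B]|.

Definition dangerous (m : nat) (B : {set 'I_m * 'I_m}) : {set vertex m} :=
  [set v | m < 10 * deg B v].

(* Used with J the set of dangerous vertices: see [sum_outdeg] for what is gained by
   discarding the edges inside J, and [deg_le_outdeg] for what is lost. *)
Definition outdeg (m : nat) (J : {set vertex m}) (B : {set 'I_m * 'I_m})
    (v : vertex m) : nat :=
  #|[set y | (edge v y \in B) && (other v y \notin J)]|.

Lemma edge_inj m (v : vertex m) : injective (edge v).
Proof. by rewrite /edge => x y; case: v.1 => -[]. Qed.

Lemma card_vertex m : #|{: vertex m}| = 2 * m.
Proof. by rewrite card_prod card_bool card_ord. Qed.

Lemma sum_vertex m (f : vertex m -> nat) :
  \sum_v f v = \sum_i f (true, i) + \sum_i f (false, i).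
Proof.
transitivity (\sum_v f (v.1, v.2)); first by apply: eq_bigr => -[].
by rewrite -(pair_bigA _ (fun s i => f (s, i))) big_bool.
Qed.

Lemma card_sum_mem (T : finType) (A : {set T}) : #|A| = \sum_x (x \in A).
Proof. by rewrite -sum1_card big_mkcond; apply: eq_bigr => x _; case: (x \in A). Qed.

Lemma card_pair_sum (T U : finType) (B : {set T * U}) :
  #|B| = \sum_i \sum_j ((i, j) \in B).
Proof.
rewrite card_sum_mem (pair_bigA _ (fun i j => ((i, j) \in B) : nat)).
by apply: eq_bigr => -[].
Qed.

Lemma sum_deg m (B : {set 'I_m * 'I_m}) : \sum_v deg B v = 2 * #|B|.
Proof.
rewrite sum_vertex mul2n -addnn; congr (_ + _).
  rewrite card_pair_sum.
  by apply: eq_bigr => i _; rewrite /deg card_sum_mem; apply: eq_bigr => j _; rewrite inE.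
rewrite card_pair_sum exchange_big.
by apply: eq_bigr => i _; rewrite /deg card_sum_mem; apply: eq_bigr => j _; rewrite inE.
Qed.

Lemma card_dangerous m (B : {set 'I_m * 'I_m}) : #|dangerous B| * m <= 20 * #|B|.
Proof.
rewrite (_ : 20 = 10 * 2) // -mulnA -sum_deg -sum_nat_const big_distrr /=.
rewrite [leqRHS](bigID (mem (dangerous B))) /=; apply: leq_trans (leq_addr _ _).
by apply: leq_sum => v; rewrite inE => /ltnW.
Qed.

Lemma degS m (B B' : {set 'I_m * 'I_m}) v : B \subset B' -> deg B v <= deg B' v.
Proof.
by move=> BB'; apply/subset_leq_card/subsetP=> y; rewrite !inE; apply: (subsetP BB').
Qed.

Lemma deg_card m (S : {set 'I_m * 'I_m}) v : deg S v <= #|S|.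
Proof.
rewrite /deg -(card_imset _ (@edge_inj m v)).
by apply/subset_leq_card/subsetP=> _ /imsetP[y + ->]; rewrite inE.
Qed.

Lemma degU m (B S : {set 'I_m * 'I_m}) v : deg (B :|: S) v <= deg B v + #|S|.
Proof.
apply: leq_trans (leq_add (leqnn _) (deg_card S v)); rewrite /deg.
apply: leq_trans (leq_card_setU _ _); apply/subset_leq_card/subsetP=> y.
by rewrite !inE.
Qed.

Lemma dangerousS m (B B' : {set 'I_m * 'I_m}) :
  B \subset B' -> dangerous B \subset dangerous B'.
Proof.
move=> BB'; apply/subsetP=> v; rewrite !inE => /leq_trans; apply.
by rewrite leq_mul2l degS.
Qed.

Lemma outdeg_le m J (B : {set 'I_m * 'I_m}) v : outdeg J B v <= deg B v.
Proof. by apply/subset_leq_card/subsetP=> y; rewrite !inE => /andP[]. Qed.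

Lemma deg_le_outdeg m J (B : {set 'I_m * 'I_m}) v : deg B v <= outdeg J B v + #|J|.
Proof.
have inj : injective (other v) by move=> x y [].
rewrite /deg -(cardsID [set y | other v y \in J]).
rewrite addnC; apply: leq_add.
  by apply/subset_leq_card/subsetP=> y; rewrite !inE andbC.
rewrite -(card_imset _ inj); apply/subset_leq_card/subsetP=> _ /imsetP[y + ->].
by rewrite !inE => /andP[].
Qed.

(** Enlarging [J] only discards old edges, so the growth of the dangerous set costs nothing here. *)
Lemma outdegU m (J J' : {set vertex m}) (B S : {set 'I_m * 'I_m}) v : J \subset J' ->
  outdeg J' (B :|: S) v <= outdeg J B v + outdeg J' S v.
Proof.
move=> JJ'; apply: leq_trans (leq_card_setU _ _); apply/subset_leq_card/subsetP=> y.
rewrite !inE => /andP[/orP[yB|yS] yJ]; last by rewrite yS yJ orbT.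
by rewrite yB (contra (subsetP JJ' _) yJ).
Qed.

(* An edge is counted only at an endpoint in J whose other endpoint is not in J. *)
Lemma sum_outdeg m (J : {set vertex m}) (S : {set 'I_m * 'I_m}) :
  \sum_(v in J) outdeg J S v <= #|S|.
Proof.
rewrite big_mkcond sum_vertex card_pair_sum.
pose g (s : bool) (i j : 'I_m) : nat :=
  [&& (s, i) \in J, edge (s, i) j \in S & (~~ s, j) \notin J].
have gE s i : (if (s, i) \in J then outdeg J S (s, i) else 0) = \sum_j g s i j.
  rewrite /g; case: ifP => _; last by rewrite big1.
  by rewrite /outdeg card_sum_mem; apply: eq_bigr => j _; rewrite inE.
rewrite (eq_bigr _ (fun i _ => gE true i)) (eq_bigr _ (fun i _ => gE false i)).
rewrite [X in _ + X]exchange_big -big_split /=; apply: leq_sum => i _.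
rewrite -big_split; apply: leq_sum => j _; rewrite /g /edge /=.
by case: (_ \in S); case: ((true, i) \in J); case: ((false, j) \in J).
Qed.

Local Open Scope ring_scope.

(** * Beck's potential *)

(** A set missed by Maker and wholly claimed by Breaker weighs 1, so a final total below 1 shows
    that Maker meets every [X i]. *)
Definition danger (R : realType) (F I : finType) (X : I -> {set F}) (lam : R)
    (M B : {set F}) : R :=
  \sum_(i | [disjoint X i & M]) expR (- (lam * #|X i :\: B|%:R)).

Lemma expR_le_double (R : realType) (x : R) :
  0 <= x -> 2 * x <= 1 -> expR x <= 1 + 2 * x.
Proof.
move=> x0 x1; have := expR_ge1Dx (- x); rewrite expRN => h.
have p := expR_gt0 x.
have x2 : 0 < 1 - x by lra.
have le1 : (1 - x) * expR x <= 1 by rewrite -ler_pdivlMr // mul1r.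
rewrite -(ler_pM2l x2); apply: le_trans le1 _.
have : 0 <= x * (1 - 2 * x) by rewrite mulr_ge0 // subr_ge0.
by lra.
Qed.

(** Maker takes the element [e] whose unmet sets have the largest total weight. With factor
    [1 / (2 * b)] exponents move by at most 1/2 per round, so the exponential is bounded linearly
    and each Breaker element adds at most [wt e / b]. *)
Lemma danger_step (R : realType) (F I : finType) (X : I -> {set F}) (b : nat)
    (M B : {set F}) :
  (0 < b)%N -> [disjoint M & B] ->
  exists D : {set F}, [/\ (#|D| <= 1)%N, [disjoint D & B] &
    forall M' S : {set F}, M :|: D \subset M' -> [disjoint M' & B :|: S] ->
      (#|S| <= b)%N ->
      danger X ((2 * b%:R)^-1 : R) M' (B :|: S) <= danger X (2 * b%:R)^-1 M B].
Proof.
move=> b0 dMB; set lam : R := (2 * b%:R)^-1.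
have bR : 0 < b%:R :> R by rewrite ltr0n.
have lam0 : 0 < lam by rewrite invr_gt0 mulr_gt0.
have lamb : 2 * (lam * b%:R) = 1 by rewrite /lam; field; rewrite lt0r_neq0.
pose w i := expR (- (lam * #|X i :\: B|%:R)).
have w0 i : 0 <= w i by exact: expR_ge0.
have wS i S : w i * expR (lam * #|X i :&: (S :\: B)|%:R) =
    expR (- (lam * #|X i :\: (B :|: S)|%:R)).
  rewrite /w -expRD; congr expR.
  rewrite -(cardsID S (X i :\: B)).
  have -> : (X i :\: B) :&: S = X i :&: (S :\: B).
    by apply/setP=> z; rewrite !inE; case: (z \in B); rewrite ?andbF.
  by rewrite setDDl natrD; ring.
case: (set_0Vmem (~: B)) => [BT|[e0 e0B]].
  exists set0; split; rewrite ?cards0 //; first by rewrite -setI_eq0 set0I.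
  move=> M' S MM' dM _.
  have {}BT : B = setT by rewrite -[B]setCK BT setC0.
  have M0 : M = set0 by move: dMB; rewrite BT -setI_eq0 setIT => /eqP.
  have M'0 : M' = set0 by move: dM; rewrite BT setTU -setI_eq0 setIT => /eqP.
  by rewrite BT M0 M'0 setTU.
pose wt f := \sum_(i | [disjoint X i & M] && (f \in X i)) w i.
have [e eB emax] := Order.TotalTheory.arg_maxP wt e0B.
exists [set e]; split; rewrite ?cards1 // ?disjoints1; first by have : e \in ~: B := eB; rewrite inE.
move=> M' S MM' dM' cS.
have -> : danger X lam M B = \sum_(i | [disjoint X i & M]) w i by [].
rewrite [leRHS](bigID (fun i => e \in X i)) /= -/(wt e).
have le1 : danger X lam M' (B :|: S) <=
    \sum_(i | [disjoint X i & M] && (e \notin X i)) (w i + w i * (b%:R^-1 * #|X i :&: (S :\: B)|%:R)).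
  rewrite /danger (eq_bigr (fun i => w i * expR (lam * #|X i :&: (S :\: B)|%:R))); last first.
    by move=> i _; rewrite wS.
  rewrite [leLHS]big_mkcond [leRHS]big_mkcond; apply: ler_sum => i _.
  case: ifP => [d|_]; last by case: ifP => // _; rewrite addr_ge0 ?mulr_ge0 ?invr_ge0.
  have [dM De] : [disjoint X i & M] /\ [disjoint X i & [set e]].
    by split; apply: disjointWr d; apply: subset_trans MM'; rewrite (subsetUl, subsetUr).
  rewrite dM; move: De; rewrite disjoint_sym disjoints1 => -> /=.
  set r := #|X i :&: (S :\: B)|.
  have rb : (r <= b)%N.
    by apply: leq_trans cS; apply/subset_leq_card/subsetP=> z; rewrite !inE; case/and3P.
  have rbR : lam * r%:R <= lam * b%:R by rewrite ler_wpM2l ?ler_nat // ltW.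
  have := @expR_le_double _ (lam * r%:R).
  rewrite mulr_ge0 ?(ltW lam0) // => /(_ isT) h.
  have {h} h : expR (lam * r%:R) <= 1 + 2 * (lam * r%:R) by apply: h; lra.
  rewrite -[X in X + _]mulr1 -mulrDr ler_wpM2l //; apply: le_trans h _.
  by rewrite lerD2l /lam invfM !mulrA mulfV ?mul1r ?pnatr_eq0.
apply: le_trans le1 _; rewrite big_split /= addrC lerD2r.
apply: (@le_trans _ _ (\sum_(f in S :\: B) b%:R^-1 * wt f)).
  under [leRHS]eq_bigr do rewrite mulr_sumr.
  rewrite (exchange_big_dep (fun i => [disjoint X i & M])) /=; last by move=> f i _ /andP[].
  rewrite [leLHS]big_mkcond [leRHS]big_mkcond; apply: ler_sum => i _ /=.
  case: ifP => [/andP[dM _]|_]; last first.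
    by case: ifP => // _; apply: sumr_ge0 => f _; rewrite mulr_ge0 ?invr_ge0.
  have -> : \sum_(f in S :\: B | [disjoint X i & M] && (f \in X i)) b%:R^-1 * w i =
      b%:R^-1 * w i * #|X i :&: (S :\: B)|%:R.
    rewrite mulr_natr -sumr_const; apply: eq_bigl => f.
    by rewrite dM [f \in _ :&: _]inE andbC.
  by rewrite dM (mulrC _ (w i)) -mulrA.
apply: (@le_trans _ _ (\sum_(f in S :\: B) b%:R^-1 * wt e)).
  apply: ler_sum => f; rewrite inE => /andP[fB fS].
  have fB' : f \in ~: B by rewrite inE.
  by rewrite ler_wpM2l ?invr_ge0 //; apply: emax fB'.
rewrite sumr_const -[leLHS]mulr_natl mulrA.
rewrite ler_piMl ?sumr_ge0 // ler_pdivrMr // mul1r ler_nat.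
by apply: leq_trans cS; apply/subset_leq_card/subsetDl.
Qed.

(** * Order of service *)

Definition choose_nbr (m : nat) (st : vertex m -> seq 'I_m) v y :=
  fun u => if u == v then y :: st v else st u.

(* For [lam * b = 9 / 10], Breaker's [b] edges raise the total weight by at most 9/10
   of the maximal weight, which is what one service of the heaviest vertex removes. *)
Definition weight (R : realType) (m : nat) (lam : R) (B : {set 'I_m * 'I_m})
    (st : vertex m -> seq 'I_m) (v : vertex m) : R :=
  expR (lam * (outdeg (dangerous B) B v)%:R) * 10^-1 ^+ size (st v).

Definition urgency (R : realType) (m : nat) (lam : R) (B : {set 'I_m * 'I_m})
    (st : vertex m -> seq 'I_m) : R :=
  \sum_(v in dangerous B | (size (st v) < 3)%N) weight lam B st v.

Lemma weight_ge0 (R : realType) m (lam : R) (B : {set 'I_m * 'I_m}) st v :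
  0 <= weight lam B st v.
Proof. by rewrite mulr_ge0 ?expR_ge0 // exprn_ge0 // invr_ge0. Qed.

(** A newly dangerous vertex had degree at most [m / 10] before [S], so it enters with weight at
    most [E], paid for by the growth of the dangerous set. All other increases total at most
    [9 / 10 * W], with [W] the maximal weight, and serving the heaviest vertex takes this off. *)
Lemma urgency_step (R : realType) (m b : nat) (B S : {set 'I_m * 'I_m})
    (st : vertex m -> seq 'I_m) (lam E : R) :
  (0 < b)%N -> (#|S| <= b)%N -> lam = 9 / (10 * b%:R) ->
  E = expR (lam * (m%:R / 10 + b%:R)) ->
  urgency lam B st <= E * #|dangerous B|%:R ->
  (exists v, size (st v) < 3)%N ->
  exists v, [/\ (size (st v) < 3)%N,
    forall y, urgency lam (B :|: S) (choose_nbr st v y) <=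
      E * #|dangerous (B :|: S)|%:R &
    v \in dangerous (B :|: S) ->
      weight lam (B :|: S) st v <= E * expR (lam * b%:R) * (2 * m)%:R].
Proof.
move=> b0 cS lamE EE ub [v0 v0st].
have bR : 0 < b%:R :> R by rewrite ltr0n.
have lam0 : 0 < lam by rewrite lamE divr_gt0 ?mulr_gt0.
have lamb : lam * b%:R = 9 / 10 by rewrite lamE; field; rewrite lt0r_neq0.
have E0 : 0 < E by rewrite EE expR_gt0.
set B' := B :|: S; set J := dangerous B in ub; set J' := dangerous B'.
have JJ' : J \subset J' by apply/dangerousS/subsetUl.
pose r v := outdeg J' S v.
have r_b v : (r v <= b)%N.
  by apply: leq_trans cS; apply: leq_trans (outdeg_le _ _ _) (deg_card _ _).
have sum_r : \sum_(v in J') (r v)%:R <= b%:R :> R.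
  by rewrite -natr_sum ler_nat; apply: leq_trans cS; apply: sum_outdeg.
have wold v : weight lam B' st v <= weight lam B st v * expR (lam * (r v)%:R).
  rewrite /weight mulrAC -expRD ler_wpM2r ?exprn_ge0 ?invr_ge0 //.
  by rewrite ler_expR -mulrDr ler_wpM2l ?(ltW lam0) // -natrD ler_nat outdegU.
have wnew v : v \notin J -> weight lam B' st v <= E.
  move=> vJ; rewrite /weight -[leRHS]mulr1; apply: ler_pM; rewrite ?expR_ge0 //.
  - by rewrite exprn_ge0 // invr_ge0.
  - rewrite EE ler_expR ler_wpM2l ?(ltW lam0) //.
    apply: (@le_trans _ _ ((deg B v)%:R + b%:R)).
      rewrite -natrD ler_nat; apply: leq_trans (outdeg_le _ _ _) _.
      by apply: leq_trans (degU _ _ _) _; rewrite leq_add2l.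
    rewrite lerD2r ler_pdivlMr // -natrM ler_nat mulnC.
    by move: vJ; rewrite inE -leqNgt.
  - by rewrite exprn_ile1 ?invr_ge0 // invf_le1 ?ler1n.
have wold_ub v : v \in J -> (size (st v) < 3)%N -> weight lam B st v <= E * #|J|%:R.
  move=> vJ vst; apply: le_trans ub; rewrite /urgency (bigD1 v) ?vJ //= lerDl.
  by apply: sumr_ge0 => u _; apply: weight_ge0.
have wub v : v \in J' -> (size (st v) < 3)%N ->
    weight lam B' st v <= E * expR (lam * b%:R) * (2 * m)%:R.
  move=> vJ' vst.
  have cV (K : {set vertex m}) : (#|K| <= 2 * m)%N by rewrite -card_vertex max_card.
  have e1 : 1 <= expR (lam * b%:R).
    by apply: le_trans (expR_ge1Dx _); rewrite lerDl mulr_ge0 ?(ltW lam0).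
  have [vJ|vJ] := boolP (v \in J).
    apply: le_trans (wold v) _; rewrite [leRHS]mulrAC; apply: ler_pM.
    - exact: weight_ge0.
    - exact: expR_ge0.
    - by apply: le_trans (wold_ub v vJ vst) _; rewrite ler_wpM2l ?(ltW E0) ?ler_nat.
    - by rewrite ler_expR ler_wpM2l ?(ltW lam0) ?ler_nat.
  apply: le_trans (wnew v vJ) _; rewrite -mulrA ler_peMr ?(ltW E0) //.
  rewrite -[leLHS]mulr1 ler_pM // ler1n.
  by apply: leq_trans (cV [set v]); rewrite cards1.
pose act v := (v \in J') && (size (st v) < 3)%N.
have [w wact|noact] := pickP act; last first.
  exists v0; split=> // [y|v0J]; last by have := noact v0; rewrite /act v0J v0st.
  rewrite /urgency big1 ?mulr_ge0 ?(ltW E0) // => v /andP[vJ].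
  have := noact v; rewrite /act vJ /= /choose_nbr => vst.
  by case: eqVneq => [Ev|_]; [rewrite Ev v0st in vst | rewrite vst].
have [v vact vmax] := Order.TotalTheory.arg_maxP (weight lam B' st) wact.
have {vact} /andP[vJ' vst] : act v := vact.
exists v; split=> // [y|_]; last exact: wub.
set W := weight lam B' st v.
have {}vmax u : u \in J' -> (size (st u) < 3)%N -> weight lam B' st u <= W.
  by move=> uJ ust; apply: vmax; rewrite /act uJ.
have W0 : 0 <= W by exact: weight_ge0.
(* The bound [1 - x <= exp (- x)] is applied to the new weight, so the increase is linear in [r u]
   with no second-order loss. *)
have incr u : u \in J' -> (size (st u) < 3)%N -> weight lam B' st u <=
    (if u \in J then weight lam B st u else E) + lam * (r u)%:R * W.
  move=> uJ' ust; case: ifPn => [uJ|uJ]; last first.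
    by apply: le_trans (wnew u uJ) _; rewrite lerDl (mulr_ge0 _ W0) // mulr_ge0 ?(ltW lam0).
  have x0 : 0 <= lam * (r u)%:R by rewrite mulr_ge0 ?(ltW lam0).
  have hx := expR_ge1Dx (- (lam * (r u)%:R)).
  have ho : weight lam B' st u * expR (- (lam * (r u)%:R)) <= weight lam B st u.
    by rewrite expRN ler_pdivrMr ?expR_gt0.
  have := ler_wpM2l x0 (vmax u uJ' ust).
  have := ler_wpM2l (weight_ge0 lam B' st u) hx.
  lra.
have total : urgency lam B' st <= E * #|J'|%:R + 9 / 10 * W.
  apply: (@le_trans _ _ (\sum_(u in J' | (size (st u) < 3)%N)
      ((if u \in J then weight lam B st u else E) + lam * (r u)%:R * W))).
    by apply: ler_sum => u /andP[]; apply: incr.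
  rewrite big_split /=; apply: lerD.
    rewrite (bigID (mem J)) /=.
    apply: (@le_trans _ _ (E * #|J|%:R + E * #|J' :\: J|%:R)); last first.
      by rewrite -mulrDr -natrD cardsD (setIidPr JJ') subnKC // subset_leq_card.
    apply: lerD.
      apply: le_trans ub; rewrite /urgency le_eqVlt; apply/orP; left; apply/eqP.
      apply: eq_big => [u|u /andP[_ ->]] //.
      by case: (boolP (u \in J)) => [uJ|]; rewrite ?andbF // (subsetP JJ' u uJ) andbT.
    rewrite mulr_natr -sumr_const [leLHS]big_mkcond [leRHS]big_mkcond.
    apply: ler_sum => u _; rewrite in_setD.
    case: (boolP (u \in J)) => uJ; rewrite ?andbF ?andbT //=.
    by case: (u \in J') => //=; case: ifP => // _; exact: ltW.
  rewrite -mulr_suml ler_wpM2r // -lamb -mulr_sumr ler_wpM2l ?(ltW lam0) //.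
  apply: le_trans sum_r; rewrite [leRHS](bigID (fun u => (size (st u) < 3)%N)) /=.
  by rewrite lerDl sumr_ge0.
suff : urgency lam B' (choose_nbr st v y) + 9 / 10 * W <= urgency lam B' st.
  by move=> h; have := le_trans h total; rewrite lerD2r.
rewrite /urgency [X in _ <= X](bigD1 v) /=; last by rewrite vJ' vst.
rewrite (bigID (pred1 v)) /= addrAC; apply: lerD; last first.
  rewrite le_eqVlt; apply/orP; left; apply/eqP.
  have cE u : u != v -> choose_nbr st v y u = st u.
    by rewrite /choose_nbr => /negPf ->.
  apply: eq_big => [u|u /andP[_ /cE]].
    by have [->|/cE ->] := eqVneq u v; rewrite ?andbF.
  by rewrite /weight => ->.
apply: (@le_trans _ _ (10^-1 * W + 9 / 10 * W)); last by rewrite -/W; lra.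
rewrite lerD2r (eq_bigl (fun u => (u == v) && (size (st v) < 2)%N)); last first.
  move=> u; rewrite andbC; case: eqVneq => //= ->.
  by rewrite /choose_nbr eqxx /= vJ'.
rewrite big_mkcondr big_pred1_eq; case: ifP => _; last first.
  by rewrite (mulr_ge0 _ W0) // invr_ge0.
by rewrite /W /weight /choose_nbr eqxx /= exprS mulrCA.
Qed.

Lemma expR_ge2X (R : realType) n : 2 ^+ n <= expR (n%:R : R).
Proof.
rewrite -[in leRHS](mulr1 n%:R) expRM_natl lerXn2r ?nnegrE ?expR_ge0 //.
by have := expR_ge1Dx (1 : R).
Qed.

(** After taking logarithms the weight bound leaves an out-degree of at most about
    [m / 10 + (10 / 9) * (m / 2)], roughly [0.66 * m]. The terms in [b], including at most [140 * b]
    edges to dangerous vertices, fit below [3 * m / 4]. *)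
Lemma many_available_nbrs (R : realType) (m b : nat) (B : {set 'I_m * 'I_m})
    (st : vertex m -> seq 'I_m) (lam E : R) (v : vertex m) :
  (0 < b)%N -> lam = 9 / (10 * b%:R) -> E = expR (lam * (m%:R / 10 + b%:R)) ->
  b%:R * ln (2 * m)%:R <= m%:R / 2 :> R -> (2000 * b <= m)%N ->
  (#|B| <= 7 * (m * b))%N -> (size (st v) < 3)%N ->
  (v \in dangerous B ->
    weight lam B st v <= E * expR (lam * b%:R) * (2 * m)%:R) ->
  (m <= 4 * #|[set y | edge v y \notin B]|)%N.
Proof.
move=> b0 lamE EE bln bm cB vst wv.
have bR : 0 < b%:R :> R by rewrite ltr0n.
have m0 : (0 < m)%N by lia.
have eY : (#|[set y | edge v y \notin B]| + deg B v = m)%N.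
  have -> : [set y | edge v y \notin B] = ~: [set y | edge v y \in B].
    by apply/setP=> y; rewrite !inE.
  by rewrite addnC /deg cardsC card_ord.
suff : (4 * deg B v <= 3 * m)%N by lia.
have [vJ|vJ] := boolP (v \in dangerous B); last first.
  by move: vJ; rewrite inE -leqNgt; lia.
have cJ : (#|dangerous B| <= 140 * b)%N.
  rewrite -(leq_pmul2r m0); apply: leq_trans (card_dangerous B) _; lia.
have dle := deg_le_outdeg (dangerous B) B v.
set o := outdeg _ _ _ in dle.
have lamb : lam * b%:R = 9 / 10 by rewrite lamE; field; rewrite lt0r_neq0.
have mR : 0 < (2 * m)%:R :> R by rewrite ltr0n; lia.
have h : expR (lam * o%:R) <=
    expR (7 + lam * (m%:R / 10 + b%:R) + lam * b%:R + ln (2 * m)%:R).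
  rewrite 3!expRD lnK ?posrE // -EE.
  (* At most two earlier services have divided the weight by 10 each. *)
  have w7 : 10 ^+ 2 <= expR 7 :> R by apply: le_trans (expR_ge2X _ 7); lra.
  have := wv vJ; rewrite /weight -/o => hw.
  have {}hw : expR (lam * o%:R) <= E * expR (lam * b%:R) * (2 * m)%:R * 10 ^+ size (st v).
    by rewrite -ler_pdivrMr ?exprn_gt0 // -exprVn.
  apply: le_trans hw _; rewrite mulrC -!mulrA; apply: ler_pM => //.
  - by rewrite exprn_ge0.
  - by rewrite !mulr_ge0 ?(ltW mR) ?expR_ge0 // EE expR_ge0.
  - by apply: le_trans w7; rewrite ler_weXn2l //; lra.
have {}h : lam * o%:R <= 7 + lam * (m%:R / 10 + b%:R) + lam * b%:R + ln (2 * m)%:R.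
  by rewrite -ler_expR.
have {h} := ler_wpM2l (ltW bR) h.
set L := ln _ in bln *.
have -> : b%:R * (lam * o%:R) = 9 / 10 * o%:R by rewrite mulrA (mulrC b%:R) lamb.
have -> : b%:R * (7 + lam * (m%:R / 10 + b%:R) + lam * b%:R + L) =
   7 * b%:R + (lam * b%:R) * (m%:R / 10 + b%:R) + (lam * b%:R) * b%:R + b%:R * L by ring.
rewrite lamb => h.
have bmR : 2000 * b%:R <= m%:R :> R by rewrite -natrM ler_nat.
have dleR : (deg B v)%:R <= o%:R + 140 * b%:R :> R.
  by rewrite -natrM -natrD ler_nat; lia.
rewrite -(ler_nat R) !natrM.
lra.
Qed.

(** * Choice of neighbours *)

(* [64 * 64] makes each size [s] contribute at most [2 * 4^-s] to the initial
   potential, see [trap_count_le]. *)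
Definition small (m : nat) (A : {set 'I_m}) : bool := (64 * 64 * #|A| <= m)%N.

(* A uniform choice among at least [m / 4] neighbours falls into a set [C] of size
   [#|A|] with probability at most [4 * #|A| / m]. *)
Definition trapped_weight (R : realType) (m : nat) (st : vertex m -> seq 'I_m)
    (s : bool) (A C : {set 'I_m}) : R :=
  \prod_(i in A) ((all [in C] (st (s, i)))%:R *
    (4 * #|A|%:R / m%:R) ^+ (3 - size (st (s, i)))).

Definition trap_potential (R : realType) (m : nat) (st : vertex m -> seq 'I_m) : R :=
  \sum_(T : bool * ({set 'I_m} * {set 'I_m}) |
      [&& T.2.1 != set0, small T.2.1 & #|T.2.2| == #|T.2.1|])
    trapped_weight R st T.1 T.2.1 T.2.2.

Lemma trapped_weight_ge0 (R : realType) m (st : vertex m -> seq 'I_m) s A C :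
  0 <= trapped_weight R st s A C.
Proof.
apply: prodr_ge0 => i _; rewrite mulr_ge0 // exprn_ge0 //.
by rewrite divr_ge0 // mulr_ge0.
Qed.

(** Averaging over [Y]: if [A] contains the served vertex, at most [#|C| = #|A|] choices keep the
    pair trapped, a share of at most [4 * #|A| / m], which is the factor released by one service. *)
Lemma trap_potential_step (R : realType) (m : nat) (st : vertex m -> seq 'I_m)
    (v : vertex m) (Y : {set 'I_m}) :
  (size (st v) < 3)%N -> (m <= 4 * #|Y|)%N ->
  exists2 y, y \in Y & trap_potential R (choose_nbr st v y) <= trap_potential R st.
Proof.
move=> vst mY.
have m0 : (0 < m)%N by case: v {vst} => s i; apply: leq_ltn_trans (ltn_ord i).
have mR : 0 < m%:R :> R by rewrite ltr0n.
have sumle : \sum_(y in Y) trap_potential R (choose_nbr st v y) <=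
    \sum_(y in Y) trap_potential R st.
  rewrite exchange_big /= [leRHS]exchange_big /=; apply: ler_sum => -[s [A C]] /=.
  move=> /and3P[A0 _ /eqP cAC].
  have [vA|vA] := boolP ((s == v.1) && (v.2 \in A)); last first.
    apply: ler_sum => y _; rewrite le_eqVlt; apply/orP; left; apply/eqP.
    apply: eq_bigr => i iA; rewrite /choose_nbr; case: eqVneq => // Ev.
    by move: vA; rewrite -Ev /= eqxx iA.
  case: v vst vA => s' i vst /= /andP[/eqP Es iA]; rewrite -{}Es {s'} in vst *.
  rewrite sumr_const -mulr_natr /trapped_weight.
  set q := 4 * _ / _.
  have q0 : 0 <= q by rewrite divr_ge0 // mulr_ge0.
  rewrite [in leRHS](bigD1 i) //=.
  set rest := \prod_(j in A | j != i) _; set a := (all _ _)%:R.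
  have rest0 : 0 <= rest.
    by apply: prodr_ge0 => j _; rewrite mulr_ge0 // exprn_ge0.
  have termE y : trapped_weight R (choose_nbr st (s, i) y) s A C =
      (y \in C)%:R * (a * q ^+ (2 - size (st (s, i))) * rest).
    rewrite /trapped_weight (bigD1 i) //= {1 2}/choose_nbr eqxx /= subSS -/q.
    rewrite -mulnb natrM -/a -!mulrA; congr (_ * (_ * (_ * _))).
    apply: eq_bigr => j /andP[_ ji]; rewrite /choose_nbr.
    by case: eqVneq => // -[Ej]; rewrite Ej eqxx in ji.
  rewrite (eq_bigr _ (fun y _ => termE y)) -mulr_suml.
  have -> : (3 - size (st (s, i)) = (2 - size (st (s, i))).+1)%N by lia.
  rewrite exprS.
  have x0 : 0 <= a * q ^+ (2 - size (st (s, i))) * rest.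
    by rewrite !mulr_ge0 // exprn_ge0.
  have cnt : \sum_(y in Y) (y \in C)%:R <= q * #|Y|%:R :> R.
    apply: (@le_trans _ _ #|A|%:R).
      rewrite -cAC -natr_sum ler_nat card_sum_mem big_mkcond; apply: leq_sum => y _.
      by case: (y \in Y).
    rewrite /q mulrAC ler_pdivlMr // -mulrA mulrCA ler_wpM2l //.
    by rewrite -natrM ler_nat.
  apply: le_trans (ler_wpM2r x0 cnt) _; rewrite le_eqVlt; apply/orP; left.
  by apply/eqP; ring.
apply/exists_inP; apply: contraT; rewrite negb_exists_in => /forall_inP h.
have Y0 : Y != set0 by rewrite -card_gt0; lia.
case/set0Pn: Y0 => y0 y0Y.
suff : \sum_(y in Y) trap_potential R st <
    \sum_(y in Y) trap_potential R (choose_nbr st v y) by rewrite ltNge sumle.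
apply: ltr_sum; last by move=> y yY; rewrite ltNge h.
by apply/hasP; exists y0; rewrite ?mem_index_enum.
Qed.

(** After three services everywhere no factor [4 * #|A| / m] remains, so a trapped pair weighs
    exactly 1. *)
Lemma trap_potential_expands (R : realType) (m : nat) (st : vertex m -> seq 'I_m)
    (s : bool) (A C : {set 'I_m}) :
  (forall v, 3 <= size (st v))%N -> trap_potential R st < 1 ->
  A != set0 -> small A -> #|C| = #|A| ->
  exists i y, [/\ i \in A, y \in st (s, i) & y \notin C].
Proof.
move=> full lt1 A0 sA cC.
have [/exists_inP[i iA /allPn[y yst yC]]|/exists_inPn h] :=
  boolP [exists i in A, ~~ all [in C] (st (s, i))]; first by exists i, y.
suff : 1 <= trap_potential R st by rewrite leNgt lt1.
rewrite /trap_potential (bigD1 (s, (A, C))) /=; last by rewrite A0 sA cC eqxx.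
rewrite /trapped_weight big1 ?lerDl => [|i iA].
  by apply: sumr_ge0 => T _; apply: trapped_weight_ge0.
by have := h i iA; rewrite negbK => ->; rewrite (eqP (full (s, i))) mulr1.
Qed.

(** * Initial value of the trap potential *)

Lemma expR1_le4 (R : realType) : expR 1 <= 4 :> R.
Proof.
have h : expR (1 / 2) <= 2 :> R.
  by apply: le_trans (expR_le_double _ _) _; lra.
have -> : expR 1 = expR (1 / 2) * expR (1 / 2) :> R by rewrite -expRD; congr expR; lra.
have : expR (1 / 2) * expR (1 / 2) <= 2 * 2 :> R by apply: ler_pM; rewrite ?expR_ge0.
lra.
Qed.

Lemma ffact_le_expn m s : (m ^_ s <= m ^ s)%N.
Proof.
elim: s => // s IH; rewrite ffactnSr expnSr; apply: leq_mul => //.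
exact: leq_subr.
Qed.

(** From [s ^ s / s! <= e ^ s <= 4 ^ s]; this bounds the binomial by [(4 * m / s) ^ s], cleared of
    the denominator. *)
Lemma bin_expn_le (R : realType) (m s : nat) :
  'C(m, s)%:R * s%:R ^+ s <= (4 * m%:R) ^+ s :> R.
Proof.
have [->|s0] := posnP s; first by rewrite bin0 !expr0 mulr1.
have f0 : 0 < (s`!)%:R :> R by rewrite ltr0n fact_gt0.
have h1 : s%:R ^+ s <= 4 ^+ s * (s`!)%:R :> R.
  have := @expR_ge1Dxn R s%:R s.-1 (ler0n _ _); rewrite prednK // => h.
  rewrite -ler_pdivrMr //; apply: (@le_trans _ _ (expR s%:R)); first lra.
  rewrite -[in leLHS](mulr1 s%:R) expRM_natl.
  by rewrite lerXn2r ?nnegrE ?expR_ge0 ?expR1_le4.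
have h2 : 'C(m, s)%:R * (s`!)%:R <= m%:R ^+ s :> R.
  by rewrite -natrM bin_ffact -natrX ler_nat ffact_le_expn.
apply: le_trans (ler_wpM2l (ler0n _ _) h1) _.
rewrite mulrCA exprMn; apply: ler_pM => //; rewrite ?exprn_ge0 //.
by rewrite mulr_ge0.
Qed.

(** The left side is at most [(1024 * s / m) ^ s]: choosing [A] and [C] costs two factors [m / s]
    per vertex, while three services provide three factors [s / m]. *)
Lemma trap_count_le (R : realType) (m s : nat) : (0 < s)%N -> (64 * 64 * s <= m)%N ->
  ('C(m, s) * 'C(m, s))%:R * ((4 * s%:R / m%:R) ^+ 3) ^+ s <= 4^-1 ^+ s :> R.
Proof.
move=> s0 sm; set c := 'C(m, s).
have mR : 0 < m%:R :> R by rewrite ltr0n; lia.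
have sR : 0 < s%:R :> R by rewrite ltr0n.
have le1 := bin_expn_le R m s; rewrite -/c in le1.
have -> : (c * c)%:R * ((4 * s%:R / m%:R) ^+ 3) ^+ s =
    (c%:R * s%:R ^+ s) ^+ 2 * (64 * s%:R / m%:R ^+ 3) ^+ s :> R.
  have -> : (4 * s%:R / m%:R) ^+ 3 = s%:R ^+ 2 * (64 * s%:R / m%:R ^+ 3) :> R.
    by field; exact: lt0r_neq0.
  by rewrite natrM -expr2 [in LHS]exprMn [X in _ = X * _]exprMn (exprAC _ s 2) mulrA.
apply: (@le_trans _ _ (((4 * m%:R) ^+ s) ^+ 2 * (64 * s%:R / m%:R ^+ 3) ^+ s)).
  apply: ler_wpM2r; first by rewrite exprn_ge0 // divr_ge0 ?exprn_ge0 // mulr_ge0.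
  by rewrite lerXn2r ?nnegrE ?mulr_ge0 ?exprn_ge0 ?mulr_ge0.
rewrite -exprM mulnC exprM -exprMn lerXn2r ?nnegrE ?invr_ge0 //.
  by rewrite mulr_ge0 ?exprn_ge0 ?divr_ge0 ?mulr_ge0 ?exprn_ge0.
have -> : (4 * m%:R) ^+ 2 * (64 * s%:R / m%:R ^+ 3) = 1024 * s%:R / m%:R :> R.
  by field; exact: lt0r_neq0.
rewrite ler_pdivrMr //.
have : 64 * 64 * s%:R <= m%:R :> R by rewrite -!natrM ler_nat.
lra.
Qed.

Lemma sum_quarter_le (R : realType) n : \sum_(i < n) 4^-1 ^+ i.+1 <= 3^-1 :> R.
Proof.
suff -> : \sum_(i < n) 4^-1 ^+ i.+1 = 3^-1 - 3^-1 * 4^-1 ^+ n :> R.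
  by rewrite gerBl mulr_ge0 ?exprn_ge0 ?invr_ge0.
elim: n => [|n IH]; first by rewrite big_ord0; lra.
by rewrite big_ord_recr /= IH exprS; field.
Qed.

(** Grouped by size [s], the pairs of both sides contribute at most [2 * 4^-s], and these bounds sum
    to at most [2 / 3]. *)
Lemma trap_potential_init (R : realType) (m : nat) :
  trap_potential R (fun _ : vertex m => [::]) < 1.
Proof.
rewrite /trap_potential.
pose f (s : nat) : R := ((4 * s%:R / m%:R) ^+ 3) ^+ s.
under eq_bigr => T _ do rewrite /trapped_weight /= prodr_const mul1r -/(f #|T.2.1|).
rewrite (partition_big (fun T : bool * ({set 'I_m} * {set 'I_m}) => inord #|T.2.1| : 'I_m.+1) xpredT) //=.
have card_le (A : {set 'I_m}) : (#|A| < m.+1)%N by rewrite ltnS -[leqRHS]card_ord max_card.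
apply: (@le_lt_trans _ _ (\sum_(j < m.+1) (if j == ord0 then 0 else 2 * 4^-1 ^+ j))).
  apply: ler_sum => j _.
  have inj (T : bool * ({set 'I_m} * {set 'I_m})) :
      (inord #|T.2.1| == j) = (#|T.2.1| == j).
    by rewrite -val_eqE /= inordK.
  have [/existsP[T0 /andP[/and3P[A0 sA _]]]|no] := boolP [exists T : bool * ({set 'I_m} * {set 'I_m}),
    [&& T.2.1 != set0, small T.2.1 & #|T.2.2| == #|T.2.1|] && (inord #|T.2.1| == j)].
    rewrite inj => /eqP Ej.
    have j0 : (0 < j)%N by rewrite -Ej card_gt0.
    rewrite ifN; last by rewrite -val_eqE /= -lt0n.
    pose D := [set A : {set 'I_m} | #|A| == j].
    have cD : #|D| = 'C(m, j) by rewrite card_draws card_ord.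
    apply: (@le_trans _ _ (\sum_(T in setX [set: bool] (setX D D)) f j)).
      rewrite [leLHS]big_mkcond [leRHS]big_mkcond; apply: ler_sum => -[s [A C]] _ /=.
      have f0 : 0 <= f j by rewrite !exprn_ge0 // divr_ge0 // mulr_ge0.
      rewrite (inj (s, (A, C))) !inE /=; case: (#|A| =P j) => [->|_]; rewrite ?andbF //.
      by rewrite andbT; case: (#|C| == j); rewrite ?andbF //= andbT; case: ifP.
    rewrite sumr_const !cardsX cD cardsT card_bool -[leLHS]mulr_natl [in leLHS]natrM -mulrA ler_wpM2l //.
    by apply: trap_count_le => //; rewrite -Ej.
  rewrite big1; first by case: ifP => // _; rewrite mulr_ge0 ?exprn_ge0 ?invr_ge0.
  by move=> T PT; case/negP: no; apply/existsP; exists T.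
rewrite big_ord_recl eqxx add0r.
under eq_bigr => i _ do rewrite /=.
rewrite -mulr_sumr.
have := sum_quarter_le R m; lra.
Qed.

(** * The perfect matching game *)

(* The junk value [setT] keeps the family indexed by all pairs; it is harmless, being
   at least as large as the other members. *)
Definition rect (m : nat) (T : {set 'I_m} * {set 'I_m}) : {set 'I_m * 'I_m} :=
  if small T.1 || small T.2 then setT else setX T.1 T.2.

(** Small sets on either side have more neighbours than elements, in the form that the trap
    potential delivers. *)
Definition expanding (m : nat) (M : {set 'I_m * 'I_m}) : Prop :=
  forall s (A C : {set 'I_m}), A != set0 -> small A -> #|C| = #|A| ->
    exists i y, [/\ i \in A, edge (s, i) y \in M & y \notin C].

Lemma expandingS m (M M' : {set 'I_m * 'I_m}) :
  M \subset M' -> expanding M -> expanding M'.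
Proof.
move=> MM' eM s A C A0 sA cC; have [i [y [iA /(subsetP MM') yM yC]]] := eM s A C A0 sA cC.
by exists i, y.
Qed.

Lemma card_rect (m : nat) T : (m * m <= 64 * 64 * (64 * 64) * #|@rect m T|)%N.
Proof.
rewrite /rect; case: ifPn => [_|]; first by rewrite cardsT card_prod card_ord leq_pmull.
rewrite negb_or -!ltnNge cardsX => /andP[/ltnW h1 /ltnW h2].
by have := leq_mul h1 h2; rewrite mulnACA.
Qed.

(** The [4 ^ m <= exp (2 * m)] members each keep at least [m * m / K - 7 * m * b] elements outside
    [B], where [K = (64 * 64) ^ 2]. Divided by [2 * b], this beats [2 * m] once
    [(7 + 4) * K * b < m]. *)
Lemma rect_danger (R : realType) (m b : nat) (M B : {set 'I_m * 'I_m}) :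
  (0 < b)%N -> 11 * (64 * 64 * (64 * 64))%:R * b%:R < m%:R :> R -> (#|B| <= 7 * (m * b))%N ->
  danger (@rect m) (2 * b%:R)^-1 M B < 1 :> R.
Proof.
move=> b0 bm cB; have cR := @card_rect m.
have K0 : 0 < (64 * 64 * (64 * 64))%:R :> R by rewrite ltr0n !muln_gt0.
move: (64 * 64 * (64 * 64))%N bm cR K0 => K bm cR K0.
have bR : 0 < b%:R :> R by rewrite ltr0n.
have mR : 0 < m%:R :> R by apply: lt_trans bm; rewrite !mulr_gt0.
pose x : R := (2 * b%:R)^-1 * (m%:R * m%:R / K%:R - 7 * (m%:R * b%:R)).
apply: (@le_lt_trans _ _ (\sum_(T : {set 'I_m} * {set 'I_m}) expR (- x))).
  rewrite [leLHS]big_mkcond; apply: ler_sum => T _.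
  case: ifP => _; last exact: expR_ge0.
  rewrite ler_expR lerN2 /x ler_wpM2l ?invr_ge0 ?mulr_ge0 //.
  have h : #|rect T|%:R <= #|rect T :\: B|%:R + 7 * (m%:R * b%:R) :> R.
    rewrite -!natrM -natrD ler_nat -(cardsID B (rect T)) addnC leq_add2l.
    by apply: leq_trans cB; apply/subset_leq_card/subsetIr.
  rewrite lerBlDr; apply: le_trans h; rewrite ler_pdivrMr // -!natrM ler_nat mulnC.
  exact: cR.
have cS : #|{: {set 'I_m}}| = (2 ^ m)%N.
  by rewrite -cardsT -powersetT card_powerset cardsT card_ord.
rewrite sumr_const card_prod cS -[ltLHS]mulr_natl -expnD natrX.
apply: (@le_lt_trans _ _ (expR (m + m)%:R * expR (- x))).
  by rewrite ler_wpM2r ?expR_ge0 ?expR_ge2X.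
rewrite -expRD -[ltRHS](@expR0 R) ltr_expR natrD subr_lt0 /x.
rewrite mulrC ltr_pdivlMr ?mulr_gt0 //.
have : (11 * K%:R * b%:R) * m%:R / K%:R < m%:R * m%:R / K%:R :> R.
  by rewrite (ltr_pM2r (x := K%:R^-1)) ?invr_gt0 // (ltr_pM2r mR).
have -> : 11 * K%:R * b%:R * m%:R / K%:R = 11 * b%:R * m%:R :> R by field; rewrite lt0r_neq0.
lra.
Qed.

Lemma extend_set (T : finType) (N : {set T}) k :
  (#|N| <= k <= #|T|)%N -> exists2 C : {set T}, N \subset C & #|C| = k.
Proof.
move=> /andP[Nk kT].
have : (0 < #|[set D : {set T} | D \subset ~: N & #|D| == k - #|N|]|)%N.
  by rewrite cards_draws bin_gt0; have := cardsC N; lia.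
rewrite card_gt0 => /set0Pn[D]; rewrite inE => /andP[DN /eqP cD].
exists (N :|: D); first exact: subsetUl.
rewrite cardsU (_ : N :&: D = set0) ?cards0 ?cD ?subn0 ?subnKC //.
by apply/eqP; rewrite setI_eq0 disjoint_sym disjoints_subset.
Qed.

(** Let [A] violate Hall's condition, with neighbourhood [N]. A small [A] expands; a small [~: N]
    expands from the other side, though its neighbours lie in the smaller set [~: A]; otherwise
    Maker has met the product of [A] and [~: N], which contains no edge of hers. *)
Lemma expanding_perfect_matching (m : nat) (M : {set 'I_m * 'I_m}) :
  (0 < m)%N -> expanding M -> (forall T, ~~ [disjoint rect T & M]) ->
  exists2 f : 'I_m -> 'I_m, injective f & forall i, (i, f i) \in M.
Proof.
move=> m0 eM rM.
apply: (@hall _ _ (Ordinal m0) (fun i j => (i, j) \in M)) => A.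
set N := nbhd _ A; rewrite leqNgt; apply/negP => NA.
have A0 : A != set0 by rewrite -card_gt0; lia.
have cI (C : {set 'I_m}) : (#|C| <= m)%N by rewrite -[leqRHS]card_ord max_card.
have [sA|sA] := boolP (small A).
  have [|C NC cC] := @extend_set _ N #|A|; first by rewrite card_ord ltnW //=.
  have [i [y [iA yM]]] := eM true A C A0 sA cC; case/negP; apply: (subsetP NC).
  by apply/nbhdP; exists i.
have cN : (#|N| + #|~: N| = m)%N by rewrite cardsC card_ord.
have cA : (#|A| + #|~: A| = m)%N by rewrite cardsC card_ord.
have [sN|sN] := boolP (small (~: N)).
  have [|C AC cC] := @extend_set _ (~: A) #|~: N|; first by rewrite card_ord cI andbT; lia.
  have N0 : ~: N != set0 by have := cI A; rewrite -card_gt0; lia.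
  have [j [i [jN iM iC]]] := eM false (~: N) C N0 sN cC.
  move: jN; rewrite inE => /negP; apply; apply/nbhdP; exists i => //.
  by move: iC; apply: contraNT => iA; apply: (subsetP AC); rewrite inE.
case/negP: (rM (A, ~: N)); rewrite /rect /= (negPf sA) (negPf sN) /=.
rewrite -setI_eq0; apply/eqP/setP=> -[i j]; rewrite !inE.
apply: contraTF isT => /andP[/andP[iA /negP]] + ijM; apply: contra_notN => _.
by apply/exists_inP; exists i.
Qed.

(* [B0] is Breaker's set before his last move: since urgency is controlled only
   after Maker's reply, the bound lags one half-round behind. *)
Definition serving (R : realType) (m b n : nat) (M B : {set 'I_m * 'I_m}) : Prop :=
  let lam : R := 9 / (10 * b%:R) in
  exists (st : vertex m -> seq 'I_m) (B0 : {set 'I_m * 'I_m}),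
    [/\ forall v y, y \in st v -> edge v y \in M,
        forall v, (size (st v) <= 3)%N & trap_potential R st < 1] /\
    [/\ n = (\sum_v size (st v))%N, B0 \subset B, (#|B :\: B0| <= b)%N,
        (#|B0| <= b * n)%N &
      urgency lam B0 st <= expR (lam * (m%:R / 10 + b%:R)) * #|dangerous B0|%:R].

Definition finishing (R : realType) (m b : nat) (M B : {set 'I_m * 'I_m}) : Prop :=
  expanding M /\ danger (@rect m) (2 * b%:R)^-1 M B < 1 :> R.

Lemma sum_size_choose_nbr (m : nat) (st : vertex m -> seq 'I_m) v y :
  (\sum_u size (choose_nbr st v y u) = (\sum_u size (st u)).+1)%N.
Proof.
rewrite (bigD1 v) //= [in RHS](bigD1 v) //= {1}/choose_nbr eqxx /= addSn.
by congr (_ + _).+1; apply: eq_bigr => u /negPf uv; rewrite /choose_nbr uv.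
Qed.

Lemma sum_size_le (m : nat) (st : vertex m -> seq 'I_m) :
  (forall v, size (st v) <= 3)%N -> (\sum_v size (st v) <= 6 * m)%N.
Proof.
move=> st3; apply: (@leq_trans (\sum_(v : vertex m) 3)); first exact: leq_sum.
by rewrite sum_nat_const card_vertex; lia.
Qed.

(** Three services for each of [2 * m] vertices give [n <= 6 * m], and the half-round lag gives
    [#|B| <= b * (6 * m + 1)], whence the 7. Once all are served, the trap potential gives expansion
    and the second stage begins. *)
Lemma serving_step (R : realType) (m b n : nat) (M B : {set 'I_m * 'I_m}) :
  (0 < b)%N -> b%:R * ln (2 * m)%:R <= m%:R / 2 :> R ->
  11 * (64 * 64 * (64 * 64))%:R * b%:R < m%:R :> R ->
  serving R b n M B ->
  (n <= 6 * m)%N /\ (finishing R b M B \/ exists e, e \notin B /\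
    forall M' S : {set 'I_m * 'I_m}, e |: M \subset M' -> (#|S| <= b)%N ->
      serving R b n.+1 M' (B :|: S)).
Proof.
move=> b0 bln bm [st [B0 [[stM st3 trap] [nE B0B cS cB0 urg]]]].
have bR : 0 < b%:R :> R by rewrite ltr0n.
have bm2 : (2000 * b <= m)%N.
  by rewrite -(ler_nat R) natrM; move: bm; rewrite !natrM; lra.
have m0 : (0 < m)%N by lia.
have n6 : (n <= 6 * m)%N by rewrite nE sum_size_le.
have cBn : (#|B| <= b * n.+1)%N.
  have := subset_leq_card (subsetIr B B0); have := cardsID B0 B; lia.
have cB : (#|B| <= 7 * (m * b))%N.
  by apply: leq_trans cBn _; have := leq_mul (leqnn b) n6; nia.
split=> //.
have [/existsP v_ex|full] := boolP [exists v, (size (st v) < 3)%N]; last first.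
  left; split; last exact: rect_danger.
  have {}full v : (3 <= size (st v))%N.
    by rewrite leqNgt; move/existsPn: full; apply.
  move=> s A C A0 sA cC.
  have [i [y [iA yst yC]]] := trap_potential_expands s full trap A0 sA cC.
  by exists i, y; split=> //; apply: stM.
(* Breaker's last move [B :\: B0] is the [S] of the urgency step, so it is known when [v] is
   chosen. *)
right; have [v [vst urgS wv]] := urgency_step b0 cS erefl erefl urg v_ex.
have BE : B0 :|: B :\: B0 = B.
  apply/setP=> z; rewrite !inE; have [zB0|] //= := boolP (z \in B0).
  by rewrite (subsetP B0B).
rewrite BE in urgS wv.
have mY := many_available_nbrs b0 erefl erefl bln bm2 cB vst wv.
have [y yY trapS] := trap_potential_step R vst mY.
exists (edge v y); split; first by move: yY; rewrite inE.
move=> M' S MM' cS'; exists (choose_nbr st v y), B; split; split.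
- move=> u z; rewrite /choose_nbr; case: eqVneq => [->|_] zst; last first.
    by apply: (subsetP MM'); rewrite inE stM ?orbT.
  apply: (subsetP MM'); rewrite inE; move: zst; rewrite inE => /orP[/eqP ->|/stM ->].
    by rewrite eqxx.
  by rewrite orbT.
- by move=> u; rewrite /choose_nbr; case: eqVneq.
- exact: le_lt_trans trapS trap.
- by rewrite sum_size_choose_nbr nE.
- exact: subsetUl.
- by apply: leq_trans cS'; apply/subset_leq_card/subsetP=> z; rewrite !inE; case: (z \in B).
- exact: cBn.
- exact: urgS.
Qed.

Lemma matching_game (R : realType) (m b : nat) :
  (0 < b)%N -> b%:R * ln (2 * m)%:R <= m%:R / 2 :> R ->
  11 * (64 * 64 * (64 * 64))%:R * b%:R < m%:R :> R ->
  exists P : {set 'I_m * 'I_m} -> {set 'I_m * 'I_m} -> Prop,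
  [/\ P set0 set0,
      forall M B : {set 'I_m * 'I_m}, [disjoint M & B] -> P M B ->
        exists D : {set 'I_m * 'I_m}, [/\ (#|D| <= 1)%N, [disjoint D & B] &
          forall M' S : {set 'I_m * 'I_m}, M :|: D \subset M' ->
            [disjoint M' & B :|: S] -> (#|S| <= b)%N -> P M' (B :|: S)] &
      forall M B : {set 'I_m * 'I_m}, M :|: B = setT -> P M B ->
        exists2 f : 'I_m -> 'I_m, injective f & forall i, (i, f i) \in M].
Proof.
move=> b0 bln bm; exists (fun M B => (exists n, serving R b n M B) \/ finishing R b M B).
have m0 : (0 < m)%N.
  by rewrite -(ltr_nat R); apply: le_lt_trans bm; rewrite !mulr_ge0.
split.
- left; exists 0, (fun=> [::]), set0; split; split=> //.
  + exact: trap_potential_init.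
  + by rewrite big1.
  + by rewrite setD0 cards0.
  + by rewrite cards0.
  + rewrite /urgency big1 => [|v]; first by rewrite mulr_ge0 ?expR_ge0.
    rewrite inE /deg (_ : [set y | _] = set0) ?cards0 //.
    by apply/setP=> y; rewrite !inE.
- move=> M B dMB PMB.
  have fin : finishing R b M B -> exists D : {set 'I_m * 'I_m},
      [/\ (#|D| <= 1)%N, [disjoint D & B] &
       forall M' S : {set 'I_m * 'I_m}, M :|: D \subset M' ->
         [disjoint M' & B :|: S] -> (#|S| <= b)%N ->
         (exists n, serving R b n M' (B :|: S)) \/ finishing R b M' (B :|: S)].
    move=> [eM dM]; have [D [cD dD DP]] := @danger_step R _ _ (@rect m) b M B b0 dMB.
    exists D; split=> // M' S MM' dM' cS; right; split.
      by apply: expandingS eM; apply: subset_trans MM'; apply: subsetUl.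
    by apply: le_lt_trans dM; apply: DP.
  case: PMB => // -[n /(serving_step b0 bln bm)[_ [//|[e [eB eP]]]]].
  exists [set e]; rewrite cards1 disjoints1 eB; split=> // M' S MM' _ cS.
  by left; exists n.+1; apply: eP => //; rewrite setUC.
- move=> M B MB PMB.
  have [eM dM] : finishing R b M B.
    (* On a full board the edge called for is already Maker's, so services go on without moves;
       [6 * m - n] drops until the finishing stage is reached. *)
    case: PMB => // -[n]; have [k] := ubnP (6 * m - n).
    elim: k n => // k IH n kn sMB.
    have [n6 [//|[e [eB eP]]]] := serving_step b0 bln bm sMB.
    have eM : e \in M by have := in_setT e; rewrite -MB inE (negPf eB) orbF.
    have := eP M set0; rewrite cards0 setU0 subUset sub1set eM subxx => /(_ isT isT) sS.
    by have [n6' _] := serving_step b0 bln bm sS; apply: IH sS; lia.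
  apply: expanding_perfect_matching m0 eM _ => T; apply: contraL dM => dT; rewrite -leNgt.
  rewrite /danger (bigD1 T) //= (_ : rect T :\: B = set0).
    by rewrite cards0 mulr0 oppr0 expR0 lerDl sumr_ge0 // => i _; apply: expR_ge0.
  apply/setP=> z; rewrite !inE; have := in_setT z; rewrite -MB inE.
  have [zB|zB] //= := boolP (z \in B); rewrite orbF => zM.
  by apply/negbTE; apply: contraL zM => zT; rewrite (disjointFr dT).
Qed.

(** * From the matching game to the Hamilton cycle game *)

Theorem theorem4 (R : realType) (k l : nat) (hk : (2 <= k)%N)
    (hl : (2 * l < k)%N) :
  exists n0 : nat, forall n : nat, (n0 <= n)%N -> (k - l %| n)%N ->
    forall b : nat, (0 < b)%N ->
      b%:R <= n%:R / (2 * k%:R * ln n%:R) :> R ->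
      maker_wins_hamilton_cycle_game n k l b.
Proof.
have [K K0 KE] : exists2 K : R, 0 < K & K = 11 * (64 * 64 * (64 * 64))%:R.
  by eexists; last reflexivity; rewrite mulr_gt0 // ltr0n !muln_gt0.
(* The bound [3 * k] ensures more than two blocks; [expR K] makes the logarithm at least [K], hence
   [K * b < t]. *)
exists (maxn (3 * k) (Num.bound (expR K))) => n; rewrite geq_max => /andP[kn Kn] dn b b0.
case: n kn Kn dn => [|n] kn Kn dn bn; first by lia.
have kn1 : (k <= n.+1)%N by apply: leq_trans kn; rewrite leq_pmull.
have [t nE] : exists t, n.+1 = ((k - l) * t)%N.
  by exists (n.+1 %/ (k - l))%N; rewrite mulnC divnK.
have tk : ((k - l) * t <= k * t)%N by rewrite leq_mul2r leq_subr orbT.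
have t2 : (2 < t)%N by rewrite -(@ltn_pmul2l k) ?(ltn_trans _ hk) //; lia.
have nR : 0 < n.+1%:R :> R by rewrite ltr0n.
have bR : 0 < b%:R :> R by rewrite ltr0n.
have kR : 0 < k%:R :> R by rewrite ltr0n; lia.
have lnK : K <= ln n.+1%:R.
  rewrite -[K]expRK ler_ln ?posrE ?expR_gt0 //.
  apply: ltW; apply: lt_le_trans (archi_boundP (expR_ge0 K)) _.
  by rewrite ler_nat.
have ln0 : 0 < ln n.+1%:R :> R by apply: lt_le_trans lnK.
have bln : b%:R * ln n.+1%:R <= t%:R / 2 :> R.
  move: bn; rewrite ler_pdivlMr ?mulr_gt0 // => bn.
  rewrite -(ler_pM2l kR); apply: (@le_trans _ _ (n.+1%:R / 2)); first by lra.
  by rewrite nE mulrA ler_pM2r ?invr_gt0 // -natrM ler_nat.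
(* Blocks have length at least 2, so [2 * t <= n.+1]. *)
have bln2 : b%:R * ln (2 * t)%:R <= t%:R / 2 :> R.
  apply: le_trans bln; rewrite ler_wpM2l // ler_ln ?posrE ?ltr0n ?ler_nat; last by lia.
    by rewrite nE leq_mul2r; lia.
  by rewrite muln_gt0; lia.
have bK : K * b%:R < t%:R.
  apply: (@le_lt_trans _ _ (b%:R * ln n.+1%:R)); first by rewrite mulrC ler_wpM2l.
  apply: le_lt_trans bln _; rewrite ltr_pdivrMr // ltr_pMr ?ltr0n ?ltr1n //; lia.
rewrite KE in bK; have [P [P0 Pstep Pend]] := matching_game b0 bln2 bK.
clear K K0 KE Kn lnK bK.

apply: (maker_wins_pullback (phi := cycle_piece n k l (t := t)) set0 _ _ P0 Pstep).
- exact: cycle_piece_inj.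
- by move=> e; rewrite in_set /cycle_piece card_cycle_edge.
move=> M B MB PMB; have [|f f_inj fM] := Pend _ _ _ PMB.
  apply/setP=> e; rewrite -preimsetU !inE.
  by have := subsetP MB (cycle_piece n k l e); rewrite !inE; apply; rewrite card_cycle_edge.
apply: (hamilton_of_matching nE hl f_inj) => j.
by have := fM j; rewrite inE.
Qed.
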